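(* Let $n\ge 1$ be an integer, let $E$ be a Hilbert space and let $\tau$ be a Hausdorff topology on $E$. Let $\{T(p): p\in\mathbb{R}_+^n\}$ be an $n$-parameter $\tau$-continuous semigroup of nonexpansive mappings on a bounded closed convex subset $C$ of $E$. Let $p_1,\dots,p_n\in\mathbb{R}_+^n$ be linearly independent (over $\mathbb{R}$, in the usual sense). Let $\alpha_1,\dots,\alpha_n\in\mathbb{R}$ be such that $\{1,\alpha_1,\dots,\alpha_n\}$ is linearly independent over $\mathbb{Q}$ and $p_0=\alpha_1p_1+\cdots+\alpha_np_n\in\mathbb{R}_+^n$. Let $x\in C$ and define a sequence $\{x_k\}$ in $C$ by $$x_k=\frac{1}{k^{n+1}}\sum_{(\nu_0,\nu_1,\dots,\nu_n)\in\{1,2,\dots,k\}^{n+1}}T\Big(\sum_{j=0}^n\nu_jp_j\Big)x\qquad(k\in\mathbb{N}).$$ Then $\{x_k\}$ converges weakly to a common fixed point of $\{T(p): p\in\mathbb{R}_+^n\}$.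
   Context: $\mathbb{N}$ is the set of positive integers and $\mathbb{R}_+^n=[0,\infty)^n$. A family $\{T(p): p\in\mathbb{R}_+^n\}$ of mappings from $C$ into $C$ is an $n$-parameter $\tau$-continuous semigroup of nonexpansive mappings on $C$ if (sg 1) $T(p+q)=T(p)\circ T(q)$ for all $p,q\in\mathbb{R}_+^n$; (sg 2) for each $x\in C$, the map $p\mapsto T(p)x$ from $\mathbb{R}_+^n$ into $C$ is continuous with respect to $\tau$; and (sg 3) each $T(p)$ is nonexpansive, i.e. $\|T(p)x-T(p)y\|\le\|x-y\|$ for all $x,y\in C$. A common fixed point is a $z\in C$ with $T(p)z=z$ for all $p\in\mathbb{R}_+^n$. Real numbers $\{\gamma_1,\dots,\gamma_m\}$ are linearly independent over $\mathbb{Q}$ if there is no nonzero $(\nu_1,\dots,\nu_m)\in\mathbb{Z}^m$ with $\sum_i\nu_i\gamma_i=0$. *)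

(* Defs.v *)
From HB Require Import structures.
From mathcomp Require Export all_boot all_order all_algebra.
From mathcomp Require Export sesquilinear.
From mathcomp Require Export all_classical all_reals all_analysis.
From mathcomp Require Export complex.

Set Implicit Arguments.
Unset Strict Implicit.
Unset Printing Implicit Defensive.

Export Order.TTheory GRing.Theory Num.Theory.
Export numFieldNormedType.Exports.

Local Open Scope classical_set_scope.
Local Open Scope ring_scope.

(* Hilbert spaces may be real or complex: K is R or R[i], and theta is the
   conjugation of K. *)
Inductive scalar_field (R : realType) : forall K : numFieldType, (K -> K) -> Prop :=
| real_scalars : @scalar_field R R idfun
| complex_scalars : @scalar_field R R[i] (@Num.conj R[i]).

(* A Banach space E whose norm comes from the inner product dot is a Hilbert
   space. *)
Definition norm_from_dot (K : numFieldType) (theta : K -> K)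
    (E : normedModType K) (dot : {dot E for theta}) : Prop :=
  forall u : E, `|u| ^+ 2 = dot u u.

(* An element of topology_on T is the class part of a topologicalType with
   carrier T, so that a second topology can be put on a type that already has
   one; with_topology tau is T equipped with tau. The eqType and choiceType
   structures that are also part of the class carry no information here. *)
Definition topology_on (T : Type) : Type := Topological.axioms_ T.

Definition with_topology (T : Type) (tau : topology_on T) : topologicalType :=
  Topological.Pack tau.

Definition orthant (R : realType) (n : nat) : set 'rV[R]_n :=
  [set p | forall i, 0 <= p ord0 i].
Arguments orthant : clear implicits.

(* T is total; only the values T p x with p in the orthant and x in C matter. *)
Record nonexpansive_semigroup (R : realType) (n : nat) (K : numFieldType)
    (E : normedModType K) (tau : topology_on E) (C : set E)
    (T : 'rV[R]_n -> E -> E) : Prop := {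
  semigroup_stable : forall p x, orthant R n p -> C x -> C (T p x) ;
  semigroup_add : forall p q x, orthant R n p -> orthant R n q -> C x ->
    T (p + q) x = T p (T q x) ;
  semigroup_continuous : forall x, C x ->
    {within orthant R n,
      continuous ((fun p => T p x) : 'rV[R]_n -> with_topology tau)} ;
  semigroup_nonexpansive : forall p x y, orthant R n p -> C x -> C y ->
    `|T p x - T p y| <= `|x - y|
}.

Definition common_fixed_point (R : realType) (n : nat) (E : Type) (C : set E)
    (T : 'rV[R]_n -> E -> E) (z : E) : Prop :=
  C z /\ forall p, orthant R n p -> T p z = z.

Definition rationally_independent (R : realType) (s : seq R) : Prop :=
  forall nu : 'I_(size s) -> int,
    \sum_(i < size s) (nu i)%:~R * s`_i = 0 -> forall i, nu i = 0.

Definition weakly_converges (K : numFieldType) (E : normedModType K)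
    (u : nat -> E) (z : E) : Prop :=
  forall f : {linear E -> K^o}, continuous f -> f (u k) @[k --> \oo] --> f z.

(* Main.v *)
Require Import Defs.
From HB Require Import structures.
From mathcomp Require Import all_boot all_order all_algebra.
From mathcomp Require Import sesquilinear.
From mathcomp Require Import all_classical all_reals all_analysis.
From mathcomp Require Import complex.
From mathcomp Require Import ring lra zify.

Set Implicit Arguments.
Unset Strict Implicit.
Unset Printing Implicit Defensive.

Import Order.TTheory GRing.Theory Num.Theory.
Import numFieldNormedType.Exports.

Local Open Scope classical_set_scope.
Local Open Scope ring_scope.

(* Put u_nu = T(nu_0 p_0 + ... + nu_n p_n) x. Averaging over the boxes
   {1..k}^(n+1) and passing to the limit along an ultrafilter U on the indices k
   gives a mean M_U on bounded families indexed by N^(n+1); it is invariant under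
   translations. Let w be the U-weak limit of the x_k. Then
   M_U |u - y|^2 = const + |w - y|^2, while nonexpansiveness and invariance give
   M_U |u - T(p_j) w|^2 <= M_U |u - w|^2, so T(p_j) w = w. If z is fixed by all
   the T(p_j), then |u_nu - z| decreases in each coordinate of nu, so M_U |u - z|^2
   is the infimum of |u_nu - z|^2 and does not depend on U. Comparing the two
   formulas at two U-limits shows that they coincide, so x_k converges weakly.
   Finally the subgroup generated by p_0, ..., p_n is dense by Kronecker's theorem,
   so continuity for the Hausdorff topology tau makes every common fixed point of
   the T(p_j) a fixed point of every T(p). Complex Hilbert spaces are treated as
   real ones with the inner product Re <u, v>. *)

(** * Real Hilbert spaces *)

Section RealHilbert.
Context {R : realType} {V : lmodType R} (dot : {dot V for idfun}).

Local Notation "''[' u , v ]" := (dot u v).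
Local Notation "''[' u ]" := (dot u u).

Lemma dot_sym u v : '[u, v] = '[v, u].
Proof. by rewrite hermC expr0 mul1r. Qed.

Lemma sqdotD u v : '[u + v] = '[u] + '[v] + '[u, v] *+ 2.
Proof. by rewrite linearDl !linearDr /= [dot v u]dot_sym mulr2n; ring. Qed.

Lemma sqdotB u v : '[u - v] = '[u] + '[v] - '[u, v] *+ 2.
Proof. by rewrite linearBl !linearBr /= [dot v u]dot_sym mulr2n; ring. Qed.

Lemma sqdotZ a u : '[a *: u] = a ^+ 2 * '[u].
Proof. by rewrite linearZl_LR linearZr_LR /= expr2 mulrA. Qed.

Lemma sqdot_ge0 u : 0 <= '[u].
Proof.
have [->|u0] := eqVneq u 0; first by rewrite linear0l.
by rewrite ltW // neq0_dnorm_gt0.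
Qed.

Lemma sqdot_le0 u : '[u] <= 0 -> u = 0.
Proof.
move=> u0; apply/eqP; apply: contraTT u0 => u0.
by rewrite -ltNge neq0_dnorm_gt0.
Qed.

Lemma dot_le_mean u v : '[u, v] *+ 2 <= '[u] + '[v].
Proof. by rewrite -subr_ge0 -sqdotB sqdot_ge0. Qed.

(** Limits are phrased with squared distances, so that [V] needs no norm besides its dot product. *)
Definition sq_cvg (s : nat -> V) (l : V) : Prop :=
  forall e, 0 < e -> exists N, forall n, (N <= n)%N -> '[s n - l] < e.

Definition sq_cauchy (s : nat -> V) : Prop :=
  forall e, 0 < e ->
    exists N, forall m n, (N <= m)%N -> (N <= n)%N -> '[s m - s n] < e.

Definition sq_complete : Prop :=
  forall s, sq_cauchy s -> exists l, sq_cvg s l.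

Definition sq_closed (C : set V) : Prop :=
  forall s l, (forall n, C (s n)) -> sq_cvg s l -> C l.

Definition real_convex (C : set V) : Prop :=
  forall a b t, C a -> C b -> 0 < t < 1 -> C (a + t *: (b - a)).

(* Equivalent, by scaling y, to (L y)^2 <= B '[y]. *)
Definition dot_bounded (L : V -> R) (B : R) : Prop :=
  forall y, L y *+ 2 <= B + '[y].

(** The factor t = [L y / '[y]] maximizes 2 t [L y] - t^2 ['[y]], with maximum ([L y])^2 /
    ['[y]]. *)
Lemma dot_bounded_sq (L : {scalar V}) (B : R) :
  dot_bounded L B -> forall y, L y ^+ 2 <= B * '[y].
Proof.
move=> LB y; have [->|y0] := eqVneq y 0.
  by rewrite linear0 linear0l expr0n mulr0.
have yy0 : 0 < '[y] by rewrite neq0_dnorm_gt0.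
have := LB ((L y / '[y]) *: y).
rewrite sqdotZ linearZ /= => h.
rewrite -subr_ge0 in h.
have := mulr_ge0 (ltW yy0) h.
rewrite mulr2n => {}h; rewrite -subr_ge0.
apply: le_trans h _; rewrite le_eqVlt; apply/orP; left; apply/eqP.
by field; rewrite gt_eqF.
Qed.

(** * Quadratic minimization over a closed convex set *)

Section Minimizer.
Hypothesis dot_complete : sq_complete.
Variables (C : set V) (L : {scalar V}) (B : R).
Hypotheses (C0 : C !=set0) (C_closed : sq_closed C) (C_convex : real_convex C).
Hypothesis LB : dot_bounded L B.

Let J (y : V) := '[y] - L y *+ 2.

(* w minimizes '[y] - 2 L y over C; by the parallelogram law minimizing sequences
   are Cauchy. *)
Lemma variational_inequality :
  exists2 w, C w & forall c, C c -> L (c - w) <= '[w, c - w].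
Proof.
have Jlb y : - B <= J y by have := LB y; rewrite /J; lra.
have hinf : has_inf (J @` C).
  split; first by case: C0 => c Cc; exists (J c), c.
  by exists (- B) => _ [y _ <-].
pose m := inf (J @` C).
have mle y : C y -> m <= J y by move=> Cy; apply: ge_inf; [case: hinf|exists y].
have /choice[s sP] n : exists y, C y /\ J y < m + n.+1%:R^-1.
  have [|_ [y Cy <-] yl] := @inf_adherent _ _ n.+1%:R^-1 _ hinf.
    by rewrite invr_gt0.
  by exists y.
(* The midpoint c of a and b lies in [C], and [J c] = ([J a] + [J b])/2 - ['[a - b]]/4 is at least
   m. *)
have par a b : C a -> C b -> '[a - b] <= (J a - m) *+ 2 + (J b - m) *+ 2.
  move=> Ca Cb; have := mle _ (@C_convex a b 2^-1 Ca Cb _).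
  have -> : 0 < (2^-1 : R) < 1 by apply/andP; split; lra.
  move=> /(_ isT); rewrite /J (linearD L) (linearZ_LR L) (linearB L) /=.
  rewrite sqdotD sqdotZ linearZr_LR (linearBr dot a) /= !sqdotB [dot b a]dot_sym; lra.
have inv_small (e : R) : 0 < e -> exists N, forall n, (N <= n)%N -> n.+1%:R^-1 < e.
  move=> e0; have := near_infty_natSinv_lt (PosNum e0).
  by case=> N _ h; exists N => n Nn; exact: (h n Nn).
have [w sw] : exists l, sq_cvg s l.
  apply: dot_complete => e e0.
  have [|N hN] := inv_small (e / 4); first by rewrite divr_gt0.
  exists N => i j Ni Nj.
  have [[Ci Ji] [Cj Jj]] := (sP i, sP j).
  move: (par _ _ Ci Cj) (hN _ Ni) (hN _ Nj) Ji Jj.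
  move: (i.+1%:R^-1) (j.+1%:R^-1) (J _) (J _) => ri rj Ji Jj.
  lra.
have Cw : C w by apply: C_closed sw => k; case: (sP k).
have B0 : 0 <= B by have := LB 0; rewrite linear0 linear0l; lra.
(* J passes to the limit: with d = [s k - w], [J (s k) - J w] = 2 (['[w, d] - L d]) + ['[d]], and
   Cauchy-Schwarz controls the middle term. *)
have Jw : J w <= m.
  suff Je (e : R) : 0 < e -> J w <= m + e by apply/ler_addgt0Pr.
  move=> e0.
  have [|N hN] := inv_small (e / 2); first by rewrite divr_gt0.
  set D := '[w] + B.
  have D0 : 0 <= D by rewrite addr_ge0 // sqdot_ge0.
  (* Below this radius the bound 2 D ['[d]] on (['[w, d] - L d])^2 is at most (e/4)^2. *)
  have r0 : 0 < e ^+ 2 / (32 * (D + 1)).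
    by rewrite divr_gt0 ?exprn_gt0 // mulr_gt0 //; lra.
  have [N' hN'] := sw _ r0.
  pose k := maxn N N'.
  have [Ck Jk] := sP k.
  have k1 := hN k (leq_maxl _ _).
  have k2 := hN' k (leq_maxr _ _).
  set d := s k - w in k2.
  have sE : s k = w + d by rewrite /d addrC subrK.
  have h1 : ('[w, d] - L d) ^+ 2 <= 2 * (D * '[d]).
    have a1 := dot_bounded_sq LB d.
    have a2 : '[w, d] ^+ 2 <= '[w] * '[d].
      by apply: (@dot_bounded_sq (dot w)) => y; exact: dot_le_mean.
    rewrite /D mulrDl; have := sqr_ge0 ('[w, d] + L d); nra.
  have h2 : 2 * (D * '[d]) <= (e / 4) ^+ 2.
    have h3 : '[d] * (32 * (D + 1)) < e ^+ 2 by rewrite -ltr_pdivlMr //; lra.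
    have d0 := sqdot_ge0 d.
    nra.
  have h4 : - ('[w, d] - L d) <= e / 4.
    rewrite lerNl -lerNl; apply: le_trans (ler_norm _) _; rewrite normrN.
    rewrite -(@ler_pXn2r _ 2) ?nnegrE ?normr_ge0 ?divr_ge0 ?(ltW e0) //.
    by rewrite real_normK ?num_real //; apply: le_trans h1 h2.
  have := Jk; rewrite /J sE (linearD L) sqdotD /= => h5.
  have := sqdot_ge0 d; move: h4 h5 k1; rewrite /J.
  move: (k.+1%:R^-1) => rk; lra.
exists w => // c Cc; set d := c - w.
rewrite leNgt; apply/negP => h.
have d0 := sqdot_ge0 d.
set g := L d - '[w, d].
have g0 : 0 < g by rewrite /g; lra.
(* [J (w + t d) - J w] = t (t ['[d]] - 2 g), and this t in (0, 1) satisfies t ['[d]] < g, so J would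
   drop below its minimum. *)
pose t := g / (g + '[d] + 1).
have D0 : 0 < g + '[d] + 1 by lra.
have t0 : 0 < t by rewrite divr_gt0.
have t1 : t < 1 by rewrite ltr_pdivrMr //; lra.
have := mle _ (@C_convex w c t Cw Cc _); rewrite -/d t0 t1 => /(_ isT) h1.
have : J w <= J (w + t *: d) by apply: le_trans Jw h1.
rewrite /J (linearD L) (linearZ_LR L) sqdotD sqdotZ linearZr_LR /=.
have tE : t * (g + '[d] + 1) = g by rewrite divfK // gt_eqF.
have : t * '[d] < g by rewrite -tE; nra.
rewrite /g; nra.
Qed.

End Minimizer.

(** The minimizer over the whole space represents [L]: the variational inequality applies to y and
    to -y. *)
Lemma riesz (dot_complete : sq_complete) (L : {scalar V}) (B : R) :
  dot_bounded L B -> exists v, L =1 dot v.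
Proof.
move=> LB; have [] := @variational_inequality dot_complete setT L B _ _ _ LB.
- by exists 0.
- by [].
- by [].
move=> v _ h.
have h' y : L y <= '[v, y] by have := h (y + v) I; rewrite addrK.
exists v => y; apply/eqP; rewrite eq_le h' /= -lerN2 -linearN -(linearNr dot v).
exact: h'.
Qed.

End RealHilbert.

(** * Means over boxes *)

Section BoxMean.
Context {R : realType} {d : nat}.
Implicit Types (g h : {ffun 'I_d -> nat} -> R) (k : nat).

(** ['I_k] starts at 0 while the box is {1, ..., k}^d, hence the successor. *)
Definition box_index k (nu : {ffun 'I_d -> 'I_k}) : {ffun 'I_d -> nat} :=
  [ffun j => (nu j).+1].

Definition box_mean k g : R :=
  (k%:R ^+ d)^-1 * \sum_(nu : {ffun 'I_d -> 'I_k}) g (box_index nu).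

Definition unit_step (j : 'I_d) : {ffun 'I_d -> nat} := [ffun i => nat_of_bool (i == j)].

(** As m is the sum of [m j] copies of each [unit_step j], statements about translations reduce to
    single steps. *)
Lemma multi_index_ind (P : {ffun 'I_d -> nat} -> Prop) :
  P 0 -> (forall a b, P a -> P b -> P (a + b)) -> (forall j, P (unit_step j)) ->
  forall m, P m.
Proof.
move=> P0 PD P1 m; have -> : m = \sum_j unit_step j *+ m j.
  apply/ffunP => i; rewrite sum_ffunE (bigD1 i) //= big1 => [|j ji].
    by rewrite addr0 ffunMnE ffunE eqxx natn.
  by rewrite ffunMnE ffunE eq_sym (negbTE ji) mul0rn.
apply: big_ind => // j _; elim: (m j) => // a IH.
by rewrite mulrS; apply: PD.
Qed.

Lemma box_mean_cst k (a : R) : (0 < k)%N -> box_mean k (fun=> a) = a.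
Proof.
move=> k0; rewrite /box_mean sumr_const card_ffun !card_ord.
rewrite -[a *+ _]mulr_natr natrX.
by rewrite mulrCA mulVf ?mulr1 // expf_eq0 pnatr_eq0 (gtn_eqF k0) andbF.
Qed.

Lemma box_meanD k g h :
  box_mean k (fun nu => g nu + h nu) = box_mean k g + box_mean k h.
Proof. by rewrite /box_mean big_split mulrDr. Qed.

Lemma box_meanZ k (a : R) g : box_mean k (fun nu => a * g nu) = a * box_mean k g.
Proof. by rewrite /box_mean -mulr_sumr mulrCA. Qed.

Lemma ler_box_mean k g h : (forall nu, g nu <= h nu) -> box_mean k g <= box_mean k h.
Proof.
by move=> gh; rewrite ler_wpM2l ?invr_ge0 ?exprn_ge0 //; apply: ler_sum.
Qed.

(** The face is a product of one singleton and d - 1 full factors; the extra factor [k.+1] avoids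
    the exponent d - 1. *)
Lemma card_box_face k (j : 'I_d) :
  (k.+1 * #|[pred nu : {ffun 'I_d -> 'I_k.+1} | nu j == ord_max]| = k.+1 ^ d)%N.
Proof.
pose F i : pred 'I_k.+1 := if i == j then pred1 ord_max else predT.
have -> : #|[pred nu : {ffun 'I_d -> 'I_k.+1} | nu j == ord_max]| =
          #|(family F : simpl_pred {ffun 'I_d -> 'I_k.+1})|.
  apply: eq_card => nu; rewrite !inE; apply/eqP/familyP => [nuj i|/(_ j)].
    by rewrite /F; case: eqP => [->|//]; rewrite inE nuj.
  by rewrite /F eqxx => /eqP.
rewrite card_family foldrE big_map big_enum /= (bigD1 j) //= /F eqxx card1 mul1n.
rewrite (eq_bigr (fun=> k.+1)) => [|i /negbTE ->]; last by rewrite card_ord.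
rewrite prod_nat_const -expnS; congr (_ ^ _)%N.
rewrite (eq_card (B := predC1 j)) // cardC1 card_ord prednK //.
exact: leq_ltn_trans (ltn_ord j).
Qed.

(* The cyclic shift of coordinate j permutes the box and agrees with adding
   the unit vector except on one face. *)
Lemma box_mean_shift k (j : 'I_d) g (M : R) : (forall nu, `|g nu| <= M) ->
  `|box_mean k.+1 (fun nu => g (nu + unit_step j)) - box_mean k.+1 g|
    <= M *+ 2 / k.+1%:R.
Proof.
move=> gM; pose shift (f : 'I_k.+1 -> 'I_k.+1) (nu : {ffun 'I_d -> 'I_k.+1}) :=
  [ffun i => if i == j then f (nu i) else nu i].
have shiftK f f' : cancel f f' -> cancel (shift f) (shift f').
  by move=> fK nu; apply/ffunP => i; rewrite !ffunE; case: eqP => // _; rewrite fK.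
have sbij : {on xpredT, bijective (shift (@ordS _))}.
  by apply: onW_bij; exists (shift (@ord_pred _)); apply: shiftK;
    [exact: ordSK|exact: ord_predK].
rewrite /box_mean -mulrBr [X in _ - X](reindex _ sbij) /= -sumrB normrM.
rewrite ger0_norm ?invr_ge0 ?exprn_ge0 //.
have kd : (k.+1%:R ^+ d)^-1 * (#|[pred nu : {ffun 'I_d -> 'I_k.+1} | nu j == ord_max]|%:R) =
    k.+1%:R^-1 :> R.
  rewrite -natrX -(card_box_face k j) natrM invfM -mulrA mulVf ?mulr1 //.
  rewrite pnatr_eq0 -lt0n; apply/card_gt0P.
  by exists [ffun=> ord_max]; rewrite inE ffunE.
rewrite [leRHS]mulrC -kd -mulrA ler_wpM2l ?invr_ge0 ?exprn_ge0 //.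
(* Off the face the two summands agree; on it they differ by at most 2M, and by [kd] the face is a
   fraction 1/(k+1) of the box. *)
rewrite (bigID (fun nu : {ffun 'I_d -> 'I_k.+1} => nu j == ord_max)) /=.
rewrite [X in _ + X]big1 ?addr0 => [|nu nuj].
  apply: le_trans (ler_norm_sum _ _ _) _.
  rewrite mulr_natl -sumr_const; apply: ler_sum => nu _.
  by apply: le_trans (ler_normB _ _) _; rewrite mulr2n lerD.
apply/eqP; rewrite subr_eq0; apply/eqP; congr (g _); apply/ffunP => i.
rewrite !ffunE; case: eqP => [->|_]; last by rewrite addr0.
rewrite /= modn_small; first exact: addn1.
rewrite ltnS ltn_neqAle -[X in _ && X]ltnS ltn_ord andbT.
by apply: contra nuj => /eqP nuk; apply/eqP/val_inj.
Qed.

End BoxMean.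

(** * Limits of box means along an ultrafilter *)

Section UltraMean.
Context {R : realType} {d : nat} {U : set_system nat}.
Hypotheses (U_ultra : UltraFilter U) (U_oo : \oo `<=` U).
Implicit Types (g h : {ffun 'I_d -> nat} -> R).

Definition bounded_family g := exists M, forall nu, `|g nu| <= M.

(** The image of [U] is an ultrafilter containing the compact segment [-M, M]. *)
Lemma ultra_bounded_cvg (f : nat -> R) (M : R) :
  (forall n, `|f n| <= M) -> cvg (f @ U).
Proof.
move=> fM.
have fU : UltraFilter (f @ U).
  split=> [|G PG UG]; first exact: fmap_proper_filter.
  apply/seteqP; split=> // A GA.
  have [//|UnA] := in_ultra_setVsetC (f @^-1` A) U_ultra; have GnA := UG (~` A) UnA.
  by have [x []] := filter_ex (filterI GA GnA).
have := @segment_compact R (- M) M; rewrite compact_ultra => /(_ _ fU) [].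
  suff: U (f @^-1` `[- M, M]%classic) by [].
  by apply: filterE => n /=; rewrite in_itv /= -ler_norml.
by move=> l [_ fl]; apply/cvg_ex; exists l.
Qed.

(* Meaningful for bounded families only: elsewhere the limit may not exist. *)
Definition umean g : R := lim (box_mean k g @[k --> U]).

Lemma umean_cvg g : bounded_family g -> box_mean k g @[k --> U] --> umean g.
Proof.
move=> [M gM].
(* Averaging preserves the bound M only on nonempty boxes, so k = 0 is bounded separately. *)
apply: (@ultra_bounded_cvg _ (Num.max `|box_mean 0 g| M)) => -[|k].
  by rewrite le_max lexx.
rewrite le_max; apply/orP; right; rewrite ler_norml; apply/andP; split.
  rewrite -[leLHS](@box_mean_cst R d k.+1) //; apply: ler_box_mean => nu.
  by have := gM nu; rewrite ler_norml => /andP[].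
rewrite -[leRHS](@box_mean_cst R d k.+1) //; apply: ler_box_mean => nu.
by have := gM nu; rewrite ler_norml => /andP[].
Qed.

Lemma cvg_ultra (T : topologicalType) (f : nat -> T) (l : T) :
  f @ \oo --> l -> f @ U --> l.
Proof. by move=> fl A /fl; exact: U_oo. Qed.

Lemma bounded_familyD g h : bounded_family g -> bounded_family h ->
  bounded_family (fun nu => g nu + h nu).
Proof.
by move=> [M gM] [N hN]; exists (M + N) => nu; apply: le_trans (ler_normD _ _) _; rewrite lerD.
Qed.

Lemma bounded_familyZ a g : bounded_family g -> bounded_family (fun nu => a * g nu).
Proof. by move=> [M gM]; exists (`|a| * M) => nu; rewrite normrM ler_wpM2l. Qed.

Lemma bounded_family_cst a : bounded_family (fun=> a).
Proof. by exists `|a|. Qed.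

Lemma umeanD g h : bounded_family g -> bounded_family h ->
  umean (fun nu => g nu + h nu) = umean g + umean h.
Proof.
move=> bg bh; apply/cvg_lim => //.
under eq_cvg do rewrite box_meanD.
by apply: cvgD; exact: umean_cvg.
Qed.

Lemma umeanZ a g : bounded_family g -> umean (fun nu => a * g nu) = a * umean g.
Proof.
move=> bg; apply/cvg_lim => //.
under eq_cvg do rewrite box_meanZ.
by apply: cvgMr; exact: umean_cvg.
Qed.

Lemma umean_cst a : umean (fun=> a) = a.
Proof.
apply/cvg_lim => //; apply: cvg_ultra; apply: cvg_near_cst.
by near=> k; apply: box_mean_cst; near: k; exact: nbhs_infty_gt.
Unshelve. all: by end_near. Qed.

Lemma ler_umean g h : bounded_family g -> bounded_family h ->
  (forall nu, g nu <= h nu) -> umean g <= umean h.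
Proof.
move=> bg bh gh; apply: ler_lim.
- by apply: cvgP; exact: umean_cvg.
- by apply: cvgP; exact: umean_cvg.
- by apply: filterE => k; exact: ler_box_mean.
Qed.

Lemma umean_step (j : 'I_d) g : bounded_family g ->
  umean (fun nu => g (nu + unit_step j)) = umean g.
Proof.
move=> bg; have [M gM] := bg.
apply/cvg_lim => //.
pose e k := box_mean k (fun nu => g (nu + unit_step j)) - box_mean k g.
have e0 : e k @[k --> \oo] --> (0 : R).
  rewrite -cvg_shiftS; apply/norm_cvg0P.
  apply: (@squeeze_cvgr _ _ _ _ (fun=> 0) (fun k => M *+ 2 * k.+1%:R^-1)).
  - by near=> k; rewrite normr_ge0 /=; exact: box_mean_shift.
  - exact: cvg_cst.
  - rewrite -[X in _ --> X](mulr0 (M *+ 2)); apply: cvgMr; exact: cvg_harmonic.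
rewrite -[X in _ --> X]add0r.
under eq_cvg => k do rewrite -(subrK (box_mean k g) (box_mean k _)) -/(e k).
by apply: cvgD; [exact: cvg_ultra|exact: umean_cvg].
Unshelve. all: by end_near. Qed.

Lemma umean_shift (m : {ffun 'I_d -> nat}) g : bounded_family g ->
  umean (fun nu => g (nu + m)) = umean g.
Proof.
move: m g; apply: multi_index_ind => [g _|a b IHa IHb g [M gM]|j g].
- by congr umean; apply/funext => nu; rewrite addr0.
- rewrite -(IHb g); last by exists M.
  rewrite -(IHa (fun nu => g (nu + b))); last by exists M.
  by congr umean; apply/funext => nu; rewrite addrA.
- exact: umean_step.
Qed.

End UltraMean.
Arguments umean {R d} U g.

(** * Mean ergodic theorem *)

(** If f left a neighbourhood A of l infinitely often, an ultrafilter refining [\oo] and containing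
    the indices where f is outside A would contradict the hypothesis. *)
Lemma cvg_ultraP (T : topologicalType) (f : nat -> T) (l : T) :
  (forall U : set_system nat, UltraFilter U -> \oo `<=` U -> f @ U --> l) ->
  f @ \oo --> l.
Proof.
move=> fU A lA; apply: contrapT => nA.
pose G := within (~` (f @^-1` A)) \oo.
have PG : ProperFilter G.
  split; last exact: within_filter.
  rewrite /G /within /= => h; apply: nA.
  by move: h; apply: filterS => k /= h; apply: contrapT.
have [U [U_ultra GU]] := ultraFilterLemma PG.
have UnA : U (~` (f @^-1` A)) by apply: GU; exact: withinT.
have UA : U (f @^-1` A).
  by apply: (fU U) lA => B oB; apply: GU; exact: cvg_within oB.
by have [k []] := filter_ex (filterI UA UnA).
Qed.

Section MeanErgodic.
Context {R : realType} {V : lmodType R} (dot : {dot V for idfun}).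
Local Notation "''[' u , v ]" := (dot u v).
Local Notation "''[' u ]" := (dot u u).

Variables (C : set V) (d : nat) (S : 'I_d -> V -> V).
Variables (u : {ffun 'I_d -> nat} -> V) (B : R).
Hypothesis dot_complete : sq_complete dot.
Hypotheses (C_closed : sq_closed dot C) (C_convex : real_convex C).
Hypothesis S_nonexpansive :
  forall j y z, C y -> C z -> '[S j y - S j z] <= '[y - z].
Hypothesis u_in_C : forall nu, C (u nu).
Hypothesis u_step : forall j nu, u (nu + unit_step j) = S j (u nu).
Hypothesis u_bounded : forall nu, '[u nu] <= B.

Let bounded_dot y : bounded_family (fun nu => '[u nu, y]).
Proof.
exists (B + '[y]) => nu; rewrite ler_norml.
have := dot_le_mean dot (u nu) y; have := dot_le_mean dot (u nu) (- y).
rewrite linearNr hnormN /= => h1 h2; have h3 := u_bounded nu.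
have := sqdot_ge0 dot y; have := sqdot_ge0 dot (u nu).
by move=> h4 h5; apply/andP; split; lra.
Qed.

Let bounded_sq y : bounded_family (fun nu => '[u nu - y]).
Proof.
exists ((B + '[y]) *+ 2) => nu; rewrite ger0_norm ?sqdot_ge0 // sqdotB.
have := dot_le_mean dot (u nu) (- y).
by rewrite linearNr hnormN /=; have := u_bounded nu; lra.
Qed.

Let bounded_sq0 : bounded_family (fun nu => '[u nu]).
Proof. by exists B => nu; rewrite ger0_norm ?sqdot_ge0. Qed.

Lemma sq_antitone z : C z -> (forall j, S j z = z) ->
  forall m nu, '[u (nu + m) - z] <= '[u nu - z].
Proof.
move=> Cz Sz; apply: multi_index_ind => [nu|a b IHa IHb nu|j nu].
- by rewrite addr0.
- by rewrite addrA; apply: le_trans (IHb _) (IHa _).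
- by have := S_nonexpansive j (u_in_C nu) Cz; rewrite u_step Sz.
Qed.

Section Ultra.
Variable U : set_system nat.
Hypotheses (U_ultra : UltraFilter U) (U_oo : \oo `<=` U).

Lemma umean_sq y : umean U (fun nu => '[u nu - y]) =
  umean U (fun nu => '[u nu]) + '[y] - umean U (fun nu => '[u nu, y]) *+ 2.
Proof.
rewrite -mulr_natl -mulNr -umeanZ //.
rewrite -[X in _ + X + _](@umean_cst R d _ U_ultra U_oo) -umeanD //; last first.
  exact: bounded_family_cst.
rewrite -umeanD //; first 1 last.
- exact/bounded_familyD/bounded_family_cst.
- exact: bounded_familyZ.
by congr umean; apply/funext => nu; rewrite sqdotB mulNr mulr_natl.
Qed.

(** By invariance the mean is that of ['[u (mu + nu) - z]], each of which is at most
    ['[u nu - z]]. *)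
Lemma umean_sq_fixed z : C z -> (forall j, S j z = z) ->
  forall nu, umean U (fun mu => '[u mu - z]) <= '[u nu - z].
Proof.
move=> Cz Sz nu.
rewrite -(umean_shift U_ultra U_oo nu (bounded_sq z)) -[leRHS](@umean_cst R d _ U_ultra U_oo).
apply: ler_umean => //.
- by have [M zM] := bounded_sq z; exists M.
- exact: bounded_family_cst.
- by move=> mu; rewrite [mu + nu]addrC; exact: sq_antitone.
Qed.

Lemma umean_weak_limit : exists w, [/\ C w, forall j, S j w = w &
  forall y, umean U (fun nu => '[u nu, y]) = '[w, y]].
Proof.
pose L y := umean U (fun nu => '[u nu, y]).
have L_linear : scalar L.
  move=> a y z; rewrite /L -umeanZ // -umeanD //; last exact: bounded_familyZ.
  by congr umean; apply/funext => nu; rewrite linearDr linearZr_LR.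
have LB : dot_bounded dot L B.
  move=> y; rewrite /L -mulr_natl -umeanZ // -[leRHS](@umean_cst R d _ U_ultra U_oo).
  apply: ler_umean => //; [exact: bounded_familyZ|exact: bounded_family_cst|].
  move=> nu; rewrite mulr_natl; apply: le_trans (dot_le_mean _ _ _) _.
  by rewrite lerD2r.
pose L' : {scalar V} := HB.pack L (GRing.isLinear.Build R V R *%R L L_linear).
have [v Lv] := @riesz _ _ dot dot_complete L' B LB.
have C0 : C !=set0 by exists (u 0).
(* Minimizing ['[y] - '[v, y] *+ 2] amounts to minimizing the distance to v, so w is the projection
   of v onto [C]. *)
have [w Cw w_proj] := @variational_inequality _ _ dot dot_complete C
  (dot v) '[v] C0 C_closed C_convex (dot_le_mean dot v).
(* Every [u nu] satisfies ['[v - w, u nu - w] <= 0]; taking means replaces [u nu] by v and gives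
   ['[v - w] <= 0]. *)
have vw : v = w.
  apply/eqP; rewrite -subr_eq0; apply/eqP/(@sqdot_le0 _ _ dot).
  rewrite linearBl /= subr_le0 -(Lv (v - w)) -[leRHS](@umean_cst R d _ U_ultra U_oo).
  apply: ler_umean => //; first exact: bounded_family_cst.
  move=> nu; have := w_proj _ (u_in_C nu).
  by rewrite !linearBr /= ![dot (u nu) _]dot_sym [dot w v]dot_sym; lra.
have Lw y : umean U (fun nu => '[u nu, y]) = '[w, y] by rewrite -vw; exact: Lv.
exists w; split=> // j.
have : umean U (fun nu => '[u nu - S j w]) <= umean U (fun nu => '[u nu - w]).
  rewrite -(umean_step U_ultra U_oo j (bounded_sq (S j w))).
  apply: ler_umean => //; first by have [M zM] := bounded_sq (S j w); exists M.
  by move=> nu; rewrite u_step; exact: S_nonexpansive.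
rewrite !umean_sq !Lw => h; apply/esym/eqP; rewrite -subr_eq0; apply/eqP.
by apply: (@sqdot_le0 _ _ dot); rewrite sqdotB; move: h; lra.
Qed.

End Ultra.

Theorem mean_ergodic : exists z, [/\ C z, forall j, S j z = z &
  forall y, box_mean k (fun nu => '[u nu, y]) @[k --> \oo] --> '[z, y]].
Proof.
have [U [U_ultra U_oo]] := @ultraFilterLemma nat \oo _.
have [z [Cz Sz zP]] := umean_weak_limit U_ultra U_oo.
exists z; split=> // y.
apply: cvg_ultraP => W W_ultra W_oo.
have [w [Cw Sw wP]] := umean_weak_limit W_ultra W_oo.
suff -> : z = w by rewrite -wP; exact: umean_cvg.
(* The mean along U1 is below every single value by [umean_sq_fixed], hence below the mean along
   U2. *)
have swap (a : V) (U1 U2 : set_system nat) : C a -> (forall j, S j a = a) ->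
    UltraFilter U1 -> \oo `<=` U1 -> UltraFilter U2 -> \oo `<=` U2 ->
    umean U1 (fun nu => '[u nu - a]) <= umean U2 (fun nu => '[u nu - a]).
  move=> Ca Sa U1u U1o U2u U2o; rewrite -[leLHS](@umean_cst R d _ U2u U2o).
  by apply: ler_umean => //; [exact: bounded_family_cst|move=> nu; exact: umean_sq_fixed].
have hz := swap _ _ _ Cz Sz W_ultra W_oo U_ultra U_oo.
have hw := swap _ _ _ Cw Sw U_ultra U_oo W_ultra W_oo.
(* Adding [hz] and [hw] cancels the means of ['[u nu]] along U and W and leaves 2 ['[z - w]] <=
   0. *)
apply/eqP; rewrite -subr_eq0; apply/eqP/(@sqdot_le0 _ _ dot); rewrite sqdotB.
move: hz hw; rewrite !umean_sq // !wP !zP [dot w z]dot_sym; lra.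
Qed.

End MeanErgodic.

(** * Kronecker's theorem *)

(** Since (N+1) C(2N+2, N+1) = 2 (2N+1) C(2N, N), induction gives 4^(N+1) <= 2 (N+1) C(2N+2,
    N+1). *)
Lemma central_bin_lower N : (4 ^ N <= (N.*2).+1 * 'C(N.*2, N))%N.
Proof.
elim: N => // N IH; rewrite doubleS expnS.
have h1 := mul_bin_diag N.*2.+2 N; have h2 := mul_bin_down N.*2.+1 N.
move: h1 h2 IH; rewrite /= -!addnn -[(N + N).+1]/((N + N).+1).
move: 'C((N + N).+2, N.+1) 'C((N + N).+1, N) 'C(N + N, N) (4 ^ N)%N => a b c x.
have -> : ((N + N).+1 - N = N.+1)%N by rewrite -addSn addnK.
nia.
Qed.

(** * Trigonometric sums and powers of cosines *)

Section Trigonometry.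
Context {R : realType}.
Implicit Types (s t x y : R).

(** After multiplication by 2 sin(theta/2) the sum telescopes to a difference of two sines. *)
Lemma cos_sum_bound theta phi : sin (theta / 2) != 0 ->
  exists M, forall K, `|\sum_(0 <= k < K) cos (k%:R * theta + phi)| <= M :> R.
Proof.
move=> s0; exists (`|sin (theta / 2)|^-1) => K.
pose F k : R := sin (k%:R * theta - theta / 2 + phi).
have step k : 2 * sin (theta / 2) * cos (k%:R * theta + phi) = F k.+1 - F k.
  rewrite /F -natr1 mulrDl mul1r.
  rewrite [X in sin X - _](_ : _ = (k%:R * theta + phi) + theta / 2); last by field.
  rewrite [X in _ - sin X](_ : _ = (k%:R * theta + phi) - theta / 2); last by field.
  by rewrite sinD sinB; ring.
have tele : 2 * sin (theta / 2) * (\sum_(0 <= k < K) cos (k%:R * theta + phi)) = F K - F 0.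
  by rewrite mulr_sumr (eq_bigr _ (fun k _ => step k)) telescope_sumr.
have s0' : 0 < `|sin (theta / 2)| by rewrite normr_gt0.
rewrite -(ler_pM2l s0') mulfV ?normr_eq0 // -normrM.
have : `|2 * sin (theta / 2) * (\sum_(0 <= k < K) cos (k%:R * theta + phi))| <= 2.
  rewrite tele; apply: le_trans (ler_normB _ _) _.
  by have := sin_max (K%:R * theta - theta / 2 + phi);
     have := sin_max (0%:R * theta - theta / 2 + phi); rewrite /F; lra.
rewrite -mulrA [X in X <= _ -> _]normrM ger0_norm //; lra.
Qed.

(** Only the constant term at [a0] survives averaging over k: the other terms have bounded partial
    sums, so K ([A a0] - D) stays bounded in K. *)
Lemma trig_poly_mean (I : finType) (a0 : I) (A theta phi : I -> R) (D : R) :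
  theta a0 = 0 -> phi a0 = 0 ->
  (forall a, a != a0 -> sin (theta a / 2) != 0) ->
  (forall k : nat, \sum_a A a * cos (k%:R * theta a + phi a) <= D) -> A a0 <= D.
Proof.
move=> th0 ph0 sn FD.
have /choice[M MP] a : exists M, a != a0 ->
    forall K, `|\sum_(0 <= k < K) cos (k%:R * theta a + phi a)| <= M.
  have [->|an] := eqVneq a a0; first by exists 0.
  by have [M hM] := @cos_sum_bound (theta a) (phi a) (sn _ an); exists M.
rewrite leNgt; apply/negP => AD.
pose S := \sum_(a | a != a0) `|A a| * M a.
have bound K : K%:R * (A a0 - D) <= S.
  have : \sum_(0 <= k < K) (\sum_a A a * cos (k%:R * theta a + phi a)) <= K%:R * D.
    rewrite mulr_natl -[X in D *+ X]subn0 -sumr_const_nat.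
    by apply: ler_sum => k _; exact: FD.
  rewrite exchange_big /= (bigD1 a0) //=.
  under eq_bigr do rewrite th0 ph0 mulr0 addr0 cos0 mulr1.
  rewrite sumr_const_nat subn0.
  have : - S <= \sum_(a | a != a0) \sum_(0 <= k < K) A a * cos (k%:R * theta a + phi a).
    rewrite lerNl -sumrN; apply: ler_sum => a an.
    rewrite -mulr_sumr; apply: le_trans (ler_norm _) _.
    by rewrite normrN normrM ler_wpM2l // MP.
  by rewrite -[A a0 *+ K]mulr_natl; lra.
have AD' : 0 < A a0 - D by lra.
have := bound (Num.bound `|S / (A a0 - D)|).
rewrite -ler_pdivlMr // leNgt => /negP; apply.
apply: le_lt_trans (ler_norm _) _.
exact/archi_boundP/normr_ge0.
Qed.

Lemma sin_pi_int (z : int) : sin (pi * z%:~R) = 0 :> R.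
Proof.
have sn (n : nat) : sin (pi * n%:R) = 0 :> R.
  elim: n => [|n IH]; first by rewrite mulr0 sin0.
  by rewrite -natr1 mulrDr mulr1 sinDpi IH oppr0.
by case: z => n; rewrite ?NegzE ?mulrNz ?mulrN ?sinN -?pmulrn ?sn ?oppr0.
Qed.

Lemma sin_pi_addz (z : int) x : sin (pi * (z%:~R + x)) ^+ 2 = sin (pi * x) ^+ 2.
Proof.
have := cos2Dsin2 (pi * z%:~R : R).
by rewrite mulrDr sinD sin_pi_int mul0r add0r expr0n addr0 exprMn => ->; rewrite mul1r.
Qed.

Lemma floor_decomp s : exists (z : int) (f : R), s = z%:~R + f /\ 0 <= f < 1.
Proof.
exists (Num.floor s), (s - (Num.floor s)%:~R); split; first by rewrite addrC subrK.
have := floor_itv s; rewrite intrD; lra.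
Qed.

Lemma sin_pi_neq0 s : (forall z : int, s != z%:~R) -> sin (pi * s) != 0.
Proof.
move=> sz; have [z [f [sE /andP[f0 f1]]]] := floor_decomp s.
have fn0 : 0 < f.
  rewrite lt_neqAle f0 andbT; apply: contra (sz z) => /eqP f00.
  by rewrite sE -f00 addr0.
rewrite -sqrf_eq0 sE sin_pi_addz sqrf_eq0 gt_eqF // sin_gt0_pi //.
by rewrite mulr_gt0 ?pi_gt0 //= -[ltRHS]mulr1 ltr_pM2l ?pi_gt0.
Qed.

Lemma cos_pi_bound e : 0 < e -> exists r, 0 < r < 1 /\
  forall s, (forall z : int, e <= `|s - z%:~R|) -> cos (pi * s) ^+ 2 <= r.
Proof.
move=> e0; have pi0 := pi_gt0 R.
have dec s : (forall z : int, e <= `|s - z%:~R|) -> exists f,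
    [/\ e <= f, f <= 1 - e & cos (pi * s) ^+ 2 = cos (pi * f) ^+ 2].
  move=> sz; have [z [f [sE /andP[f0 f1]]]] := floor_decomp s.
  exists f; rewrite !cos2sin2 sE sin_pi_addz; split=> //.
    by have := sz z; rewrite sE addrAC subrr add0r ger0_norm.
  have := sz (z + 1); rewrite sE intrD.
  have -> : z%:~R + f - (z%:~R + 1%:~R) = f - 1 by ring.
  by rewrite ler0_norm; lra.
(* For e > 1/2 no s qualifies. Otherwise r is the value at distance e, and the maximum with 1/2
   keeps it positive when cos(pi e) = 0. *)
have [eh|eh] := lerP e (1/2); last first.
  by exists (1/2); split=> [|s /dec[f [? ? _]]]; [apply/andP; split; lra|lra].
exists (Num.max (cos (pi * e) ^+ 2) (1/2)); split.
  rewrite lt_max gt_max; apply/andP; split; first by apply/orP; right; lra.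
  apply/andP; split; last by lra.
  have c0 : 0 <= cos (pi * e) by apply: cos_ge0_pihalf; apply/andP; split; nra.
  have : cos (pi * e) < cos 0.
    by rewrite ltr_cos ?in_itv /= ?mulr_gt0 //; apply/andP; split; nra.
  by rewrite cos0 => c1; rewrite expr_lt1.
move=> s /dec[f [ef fe ->]]; rewrite le_max; apply/orP; left.
have itv t : 0 <= t -> t <= 1 -> pi * t \in `[0, pi].
  by move=> t0 t1; rewrite in_itv /=; apply/andP; split; nra.
have h1 : cos (pi * f) <= cos (pi * e).
  by rewrite leNgt ltr_cos -?leNgt ?ler_pM2l //; apply: itv; lra.
have h2 : - cos (pi * e) <= cos (pi * f).
  have -> : - cos (pi * e) = cos (pi * (1 - e)).
    by rewrite mulrBr mulr1 addrC cosDpi cosN.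
  by rewrite leNgt ltr_cos -?leNgt ?ler_pM2l //; apply: itv; lra.
nra.
Qed.

(** This is exp(i s); powers of 2 cos s = [E s + E (- s)] then expand binomially. *)
Let E s : R[i] := Complex (cos s) (sin s).

Let E_D s t : E (s + t) = E s * E t.
Proof. by rewrite /E cosD sinD; congr Complex; ring. Qed.

Let E_0 : E 0 = 1.
Proof. by rewrite /E cos0 sin0. Qed.

Let E_X s m : E s ^+ m = E (m%:R * s).
Proof. by elim: m => [|m IH]; rewrite ?mul0r ?E_0 // exprS IH -E_D -natr1; congr E; ring. Qed.

Let E_cos s : (2 * cos s)%:C%C = E s + E (- s).
Proof.
by rewrite /E cosN sinN /GRing.add /= subrr; congr Complex; rewrite mulr_natl mulr2n.
Qed.

(** Real part of a product of binomial expansions: choosing the term [a j] in factor j contributes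
    the frequency m - 2 [a j]. *)
Lemma prod_cos_expand n m (x : 'I_n -> R) :
  \prod_j (2 * cos (x j)) ^+ m =
  \sum_(a : {ffun 'I_n -> 'I_m.+1}) (\prod_j 'C(m, a j)%:R) *
     cos (\sum_j (m%:R - 2 * (a j)%:R) * x j).
Proof.
have ReM (c : R) z : complex.Re (c%:C%C * z) = c * complex.Re z.
  by case: z => a b /=; rewrite mul0r subr0.
have ReD : {morph @complex.Re R : z w / z + w} by move=> [a b] [c d].
have eC : (\prod_j (2 * cos (x j)) ^+ m)%:C%C =
  \sum_(a : {ffun 'I_n -> 'I_m.+1}) (\prod_j 'C(m, a j)%:R)%:C%C *
     E (\sum_j (m%:R - 2 * (a j)%:R) * x j).
  rewrite rmorph_prod.
  rewrite (eq_bigr (fun j => \sum_(i < m.+1)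
    ('C(m, i)%:R)%:C%C * E ((m%:R - 2 * i%:R) * x j))).
    rewrite bigA_distr_bigA; apply: eq_bigr => a _.
    by rewrite big_split /= rmorph_prod (big_morph E E_D E_0).
  move=> j _; rewrite rmorphXn /= E_cos exprDn; apply: eq_bigr => i _.
  have -> : (m%:R - 2 * i%:R) * x j = (m - i)%:R * x j + i%:R * - x j.
    by rewrite natrB; [ring|rewrite -ltnS].
  by rewrite E_D -!E_X rmorph_nat mulr_natl.
have Re0 : @complex.Re R 0 = 0 by [].
rewrite -[LHS]/(complex.Re (\prod_j (2 * cos (x j)) ^+ m)%:C%C) eC.
rewrite (big_morph _ ReD Re0).
by apply: eq_bigr => a _; rewrite ReM.
Qed.

End Trigonometry.

(** * Inhomogeneous approximation modulo the integers *)

Section Kronecker.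
Context {R : realType}.

Lemma bernoulli_ineq (c : R) m : 0 <= c -> 1 + m%:R * c <= (1 + c) ^+ m.
Proof.
move=> c0; elim: m => [|m IH]; first by rewrite expr0 mul0r addr0.
rewrite exprS; apply: (@le_trans _ _ ((1 + c) * (1 + m%:R * c))).
  have : 0 <= m%:R * c ^+ 2 by rewrite mulr_ge0 // sqr_ge0.
  by rewrite -natr1; nra.
by rewrite ler_wpM2l //; lra.
Qed.

Lemma poly_lt_geometric n (r : R) : 0 < r < 1 ->
  exists N, (N.*2.+1)%:R ^+ n * r ^+ N < 1.
Proof.
move=> /andP[r0 r1]; pose c := r^-1 - 1.
have c0 : 0 < c by rewrite subr_gt0 invf_gt1.
pose D := 1 + 2 * n.+1%:R / c.
have D1 : 1 <= D by rewrite lerDl divr_ge0 ?mulr_ge0 // ltW.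
pose m := Num.bound `|D ^+ n / c|.
have Dm : D ^+ n < 1 + m%:R * c.
  have : D ^+ n / c < m%:R by apply: le_lt_trans (ler_norm _) _; apply/archi_boundP.
  by rewrite ltr_pdivrMr //; lra.
(* Bernoulli gives r^(-N) >= (1 + m c)^(n+1), while 2N + 1 <= D (1 + m c); the spare factor 1 + m c
   beats D^n. *)
exists (m * n.+1)%N; set N := (m * n.+1)%N.
have t0 : 0 < 1 + m%:R * c by rewrite ltr_pwDl // mulr_ge0 // ltW.
rewrite -ltr_pdivlMr ?exprn_gt0 // div1r -exprVn /N exprM.
have h1 : (N.*2.+1)%:R <= D * (1 + m%:R * c).
  rewrite /N -natr1 -muln2 !natrM /D.
  have -> : (1 + 2 * n.+1%:R / c) * (1 + m%:R * c) =
     m%:R * n.+1%:R * 2 + 1 + (m%:R * c + 2 * n.+1%:R / c) :> R.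
    by field; rewrite gt_eqF.
  by rewrite lerDl addr_ge0 // ?mulr_ge0 ?invr_ge0 // ltW.
have h2 : (N.*2.+1)%:R ^+ n <= D ^+ n * (1 + m%:R * c) ^+ n.
  by rewrite -exprMn lerXn2r // nnegrE // mulr_ge0 ?ltW // (lt_le_trans ltr01).
apply: le_lt_trans h2 _.
have h3 : (1 + m%:R * c) <= r^-1 ^+ m.
  by apply: le_trans (bernoulli_ineq _ (ltW c0)) _; rewrite /c addrC subrK.
apply: (@lt_le_trans _ _ ((1 + m%:R * c) ^+ n.+1)).
  by rewrite exprS ltr_pM2r // exprn_gt0.
by rewrite lerXn2r // nnegrE ?ltW // exprn_gt0 // invr_gt0.
Qed.

(* With s_j = k alpha_j - y_j, the kernel prod_j (2 cos (pi s_j))^(2N) has mean value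
   'C(2N, N)^n >= (4^N / (2N + 1))^n in k, but it is at most 4^(nN) r^N with r < 1
   as long as some s_j stays e-far from the integers. *)
Theorem kronecker n (alpha y : 'I_n -> R) (e : R) : 0 < e ->
  (forall (m : 'I_n -> int) (z : int),
     \sum_j (m j)%:~R * alpha j = z%:~R -> forall j, m j = 0) ->
  exists (k : nat) (m : 'I_n -> int),
    forall j, `|k%:R * alpha j - y j - (m j)%:~R| < e.
Proof.
move=> e0 indep; apply: contrapT => far.
have {}far k : exists j, forall z : int, e <= `|k%:R * alpha j - y j - z%:~R|.
  apply: contrapT => near; apply: far; exists k.
  have /choice[m mP] j : exists z : int, `|k%:R * alpha j - y j - z%:~R| < e.
    apply: contrapT => nj; apply: near; exists j => z.
    by rewrite leNgt; apply/negP => lt; apply: nj; exists z.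
  by exists m.
have [r [r01 rP]] := @cos_pi_bound R _ e0.
have /andP[r0 r1] := r01.
have [N NP] := poly_lt_geometric n r01.
pose x k j : R := pi * (k%:R * alpha j - y j).
(* The expansion with exponent 2N has frequencies 2 (N - [a j]); the constant term is [a0], where
   every [a j] is N. *)
pose freq (a : {ffun 'I_n -> 'I_N.*2.+1}) j : int := N%:Z - (a j)%:Z.
pose theta (a : {ffun 'I_n -> 'I_N.*2.+1}) : R := 2 * (pi * \sum_j (freq a j)%:~R * alpha j).
pose phi (a : {ffun 'I_n -> 'I_N.*2.+1}) : R := - (2 * (pi * \sum_j (freq a j)%:~R * y j)).
pose A (a : {ffun 'I_n -> 'I_N.*2.+1}) : R := \prod_j 'C(N.*2, a j)%:R.
have N2 : (N < N.*2.+1)%N by rewrite ltnS -addnn leq_addr.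
pose a0 : {ffun 'I_n -> 'I_N.*2.+1} := [ffun=> Ordinal N2].
have freq0 j : freq a0 j = 0 by rewrite /freq ffunE subrr.
have theta0 : theta a0 = 0.
  by rewrite /theta big1 ?mulr0 // => j _; rewrite freq0 mul0r.
have phi0 : phi a0 = 0.
  by rewrite /phi big1 ?mulr0 ?oppr0 // => j _; rewrite freq0 mul0r.
have Aa0 : A a0 = ('C(N.*2, N)%:R) ^+ n.
  rewrite /A (eq_bigr (fun=> 'C(N.*2, N)%:R)) => [|j _]; last by rewrite ffunE.
  by rewrite prodr_const card_ord.
(* Half of theta is pi times an integer combination of the alphas; independence makes that an
   integer only when all coefficients [freq a j] vanish. *)
have sin_theta a : a != a0 -> sin (theta a / 2) != 0.
  move=> aa0; rewrite /theta mulrC mulKf //; apply: sin_pi_neq0 => z.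
  apply: contra aa0 => /eqP /indep fz; apply/eqP/ffunP => j; apply/val_inj.
  by have /eqP := fz j; rewrite /freq subr_eq0 ffunE /= => /eqP[<-].
have expand k : \prod_j (2 * cos (x k j)) ^+ N.*2 =
    \sum_a A a * cos (k%:R * theta a + phi a).
  rewrite prod_cos_expand; apply: eq_bigr => a _; congr (_ * cos _).
  rewrite /theta /phi !mulr_sumr -sumrN -big_split; apply: eq_bigr => j _ /=.
  have -> : N.*2%:R = N%:R * 2 :> R by rewrite -natrM muln2.
  by rewrite /freq /x intrD intrN -!pmulrn; ring.
have kernel_le k : \prod_j (2 * cos (x k j)) ^+ N.*2 <= (4 ^+ N) ^+ n * r ^+ N.
  have [j jP] := far k.
  have sq i : (2 * cos (x k i)) ^+ N.*2 = (4 * cos (x k i) ^+ 2) ^+ N.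
    by rewrite -mul2n exprM; congr (_ ^+ _); ring.
  have sq_ge0 i : 0 <= 4 * cos (x k i) ^+ 2 by rewrite mulr_ge0 // sqr_ge0.
  rewrite (bigD1 j) //=.
  have n1 : (n = #|[pred i : 'I_n | i != j]|.+1)%N.
    rewrite -[LHS]card_ord (cardD1 j) inE add1n; congr _.+1.
    by apply: eq_card => i; rewrite !inE andbT.
  have -> : (4 ^+ N) ^+ n * r ^+ N =
      (4 ^+ N * r ^+ N) * (4 ^+ N) ^+ #|[pred i : 'I_n | i != j]| :> R.
    by rewrite [X in _ ^+ X * _ = _]n1 exprS mulrAC.
  apply: ler_pM.
  - by rewrite sq exprn_ge0.
  - by apply: prodr_ge0 => i _; rewrite sq exprn_ge0.
  - rewrite sq -exprMn lerXn2r ?nnegrE ?sq_ge0 ?mulr_ge0 ?(ltW r0) //.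
    by rewrite ler_wpM2l // rP.
  - rewrite -prodr_const; apply: ler_prod => i _; rewrite sq exprn_ge0 //=.
    rewrite lerXn2r ?nnegrE // -[leRHS]mulr1 ler_wpM2l //.
have := @trig_poly_mean R _ a0 A theta phi _ theta0 phi0 sin_theta
  (fun k => le_trans (eq_ind _ (fun t => t <= _) (lexx _) _ (expand k)) (kernel_le k)).
rewrite Aa0 leNgt => /negP; apply.
(* After multiplication by (2N+1)^n, the number 4^(nN) separates the two sides: [NP] on the left,
   [central_bin_lower] on the right. *)
have p0 : 0 < (N.*2.+1)%:R ^+ n :> R by rewrite exprn_gt0.
rewrite -(ltr_pM2l p0) mulrCA.
apply: (@lt_le_trans _ _ ((4 ^+ N) ^+ n)).
  by rewrite -[ltRHS]mulr1 ltr_pM2l // !exprn_gt0.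
rewrite -exprMn lerXn2r ?nnegrE ?mulr_ge0 ?exprn_ge0 //.
by rewrite -natrX -natrM ler_nat central_bin_lower.
Qed.

End Kronecker.

(** * Common fixed points *)

Section CommonFixedPoints.
Context {R : realType} {n : nat}.

Lemma orthantD (a b : 'rV[R]_n) : orthant R n a -> orthant R n b -> orthant R n (a + b).
Proof. by move=> ha hb i; rewrite mxE addr_ge0. Qed.

Lemma orthantZ (c : R) (a : 'rV[R]_n) : 0 <= c -> orthant R n a -> orthant R n (c *: a).
Proof. by move=> c0 ha i; rewrite mxE mulr_ge0. Qed.

Lemma orthant0 : orthant R n 0.
Proof. by move=> i; rewrite mxE. Qed.

Lemma rationally_independent_cons1 (alpha : n.-tuple R) :
  rationally_independent (1 :: alpha) ->
  forall (m : 'I_n -> int) (z : int),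
    \sum_(j < n) (m j)%:~R * alpha`_j = z%:~R -> forall j, m j = 0.
Proof.
move=> indep m z mz j.
(* The integer relation has coefficient -z on 1 and m on the alphas. *)
pose f (i : nat) : int := if i is j.+1 then oapp m 0 (insub j) else - z.
have fm (i : 'I_n) : f i.+1 = m i by rewrite /f valK.
have jn : (j.+1 < size (1%R :: alpha))%N by rewrite /= ltnS size_tuple.
have := indep (fun i => f i) _ (Ordinal jn); rewrite fm; apply.
rewrite -(big_mkord xpredT (fun i => (f i)%:~R * (1 :: alpha)`_i)).
have -> : size (1 :: tval alpha) = n.+1 by rewrite /= size_tuple.
rewrite big_nat_recl // big_mkord (eq_bigr (fun i : 'I_n => (m i)%:~R * alpha`_i)).
  by rewrite mz mulr1 intrN addNr.
by move=> i _; rewrite fm.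
Qed.

Lemma int_natB (z : int) : exists ab : nat * nat, z = ab.1%:Z - ab.2%:Z.
Proof.
case: z => k; first by exists (k, 0%N); rewrite subr0.
by exists (0%N, k.+1); rewrite NegzE sub0r.
Qed.

(** Kronecker's theorem in the coordinates of the basis p. Negative coefficients go to the side of
    g, because the semigroup has only parameters in the orthant. *)
Lemma orthant_dense (p : n.-tuple 'rV[R]_n) (alpha : n.-tuple R) :
  free p -> rationally_independent (1 :: alpha) ->
  forall q, orthant R n q -> forall e : R, 0 < e ->
  exists (k : nat) (a b : 'I_n -> nat) g,
    [/\ orthant R n g, (forall i, `|g ord0 i - q ord0 i| < e) &
      g + \sum_(j < n) p`_j *+ b j =
      (\sum_(j < n) alpha`_j *: p`_j) *+ k + \sum_(j < n) p`_j *+ a j].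
Proof.
move=> p_free indep q q0 e e0.
have p_basis : basis_of fullv p.
  by rewrite basisEfree p_free subvf size_tuple dimvf /dim /= mul1n.
(* Aiming e/2 above q in each coordinate puts every approximant within e/2 of q' inside the
   orthant. *)
pose q' : 'rV[R]_n := \row_i (q ord0 i + e / 2).
pose y j := coord p j q'.
have q'E : q' = \sum_(j < n) y j *: p`_j by exact: (coord_basis p_basis (memvf q')).
pose W := \sum_(j < n) \sum_i `|p`_j ord0 i|.
have W0 : 0 <= W by rewrite sumr_ge0 // => j _; rewrite sumr_ge0.
(* Errors below d in the basis coordinates move each entry by at most d W < e/2. *)
pose d := e / 2 / (W + 1).
have d0 : 0 < d by rewrite !divr_gt0 // ltr_wpDl.
have [k [m mP]] := kronecker y d0 (rationally_independent_cons1 indep).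
have /choice[ab abP] j := int_natB (m j).
pose g := \sum_(j < n) (k%:R * alpha`_j - (m j)%:~R) *: p`_j.
have gq' i : `|g ord0 i - q' ord0 i| < e / 2.
  have -> : g ord0 i - q' ord0 i =
      \sum_(j < n) (k%:R * alpha`_j - y j - (m j)%:~R) * p`_j ord0 i.
    rewrite q'E /g !summxE -sumrB; apply: eq_bigr => j _; rewrite !mxE; ring.
  apply: (@le_lt_trans _ _ (d * W)).
    apply: le_trans (ler_norm_sum _ _ _) _.
    rewrite /W mulr_sumr; apply: ler_sum => j _; rewrite normrM.
    apply: ler_pM => //; first exact: ltW.
    by rewrite (bigD1 i) //= lerDl sumr_ge0.
  by rewrite /d -mulrA gtr_pMr ?divr_gt0 // mulrC ltr_pdivrMr ?mul1r; lra.
have gq i : 0 < g ord0 i - q ord0 i < e.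
  by have := gq' i; rewrite /q' mxE ltr_norml; lra.
exists k, (fun j => (ab j).2), (fun j => (ab j).1), g; split.
- by move=> i; have := gq i; have := q0 i; lra.
- by move=> i; have := gq i; rewrite ltr_norml; lra.
rewrite -sumrMnl -!big_split; apply: eq_bigr => j _ /=.
rewrite -[p`_j *+ (ab j).2]scaler_nat -[p`_j *+ (ab j).1]scaler_nat.
rewrite -[alpha`_j *: p`_j *+ k]scaler_nat scalerA.
rewrite -!scalerDl; congr (_ *: _).
by rewrite abP intrD intrN -!pmulrn; ring.
Qed.

Context {K : numFieldType} {E : normedModType K} {tau : topology_on E}.
Context {C : set E} {T : 'rV[R]_n -> E -> E}.
Hypothesis tau_hausdorff : hausdorff_space (with_topology tau).
Hypothesis T_semigroup : nonexpansive_semigroup tau C T.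

Lemma common_fixed_pointP (p : n.-tuple 'rV[R]_n) (alpha : n.-tuple R) (z : E) :
  (forall j : 'I_n, orthant R n p`_j) -> free p ->
  rationally_independent (1 :: alpha) ->
  orthant R n (\sum_(j < n) alpha`_j *: p`_j) ->
  C z -> T (\sum_(j < n) alpha`_j *: p`_j) z = z ->
  (forall j : 'I_n, T p`_j z = z) ->
  common_fixed_point C T z.
Proof.
set p0 := \sum_(j < n) _ => p_orth p_free indep p0_orth Cz p0z pz.
have TD := semigroup_add T_semigroup.
pose F q := orthant R n q /\ T q z = z.
(* The semigroup law does not state T(0) = id; at z it follows from z = T(p0) z. *)
have F0 : F 0.
  split; first exact: orthant0.
  by have := TD 0 _ _ orthant0 p0_orth Cz; rewrite add0r p0z.
have FD a b : F a -> F b -> F (a + b).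
  move=> [a0 az] [b0 bz]; split; first exact: orthantD.
  by rewrite TD // bz.
have FM a k : F a -> F (a *+ k).
  by move=> Fa; elim: k => // k IH; rewrite mulrS; apply: FD.
have Fsum (a : 'I_n -> nat) : F (\sum_(j < n) p`_j *+ a j).
  by apply: big_ind => // j _; exact: FM.
(* By separation it suffices that each neighbourhood A of T(q) z contains z; a g near q with T(g) z
   = z shows this. *)
split=> // q q_orth; apply: tau_hausdorff => A N qA zN.
have := semigroup_continuous T_semigroup Cz.
move=> /subspace_continuousP/(_ q q_orth A qA).
rewrite /= => /nbhs_ballP[e /= e0 ballA].
have [k [a [b [g [g_orth gq gE]]]]] := orthant_dense p_free indep q_orth e0.
exists z; split; last exact: (nbhs_singleton zN).
have [b0 bz] := Fsum b.
have [_ az] : F (p0 *+ k + \sum_(j < n) p`_j *+ a j) by apply: FD => //; exact: FM.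
(* With b and g + b both fixing z, T(g) z = T(g) T(b) z = T(g + b) z = z: differences of fixing
   parameters are allowed. *)
have gz : T g z = z by rewrite -{1}bz -TD // gE az.
suff : A (T g z) by rewrite gz.
apply: (ballA g _ g_orth); split=> // i j.
by rewrite ord1 /ball /= distrC.
Qed.

End CommonFixedPoints.

(** * Real and complex scalars *)

(** A synonym of [E], so that its R-module structure does not clash with the K-module structure. *)
Definition restrict_scalars (R K : nzRingType) (emb : {rmorphism R -> K})
  (E : lmodType K) : Type := E.

Section RestrictScalars.
Context {R K : nzRingType} (emb : {rmorphism R -> K}) (E : lmodType K).
Local Notation V := (restrict_scalars emb E).

HB.instance Definition _ := GRing.Zmodule.copy V E.

Let scale (a : R) (v : V) : V := emb a *: (v : E).

Let scaleA a b v : scale a (scale b v) = scale (a * b) v.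
Proof. by rewrite /scale scalerA rmorphM. Qed.
Let scale1 : left_id 1 scale.
Proof. by move=> v; rewrite /scale rmorph1 scale1r. Qed.
Let scaleDr : right_distributive scale +%R.
Proof. by move=> a u v; exact: scalerDr. Qed.
Let scaleDl v : {morph scale^~ v : a b / a + b}.
Proof. by move=> a b; rewrite /scale rmorphD scalerDl. Qed.

HB.instance Definition _ :=
  GRing.Zmodule_isLmodule.Build R V scaleA scale1 scaleDr scaleDl.

Lemma restrict_scaleE (a : R) (v : V) : a *: v = emb a *: (v : E).
Proof. by []. Qed.

End RestrictScalars.

(** The bridge from [mean_ergodic] to semigroups: the semigroup law is the step relation, and Riesz
    turns L into a dot product. *)
Lemma mean_ergodic_semigroup (R : realType) (V : lmodType R)
    (dot : {dot V for idfun}) (C : set V) (n d : nat)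
    (T : 'rV[R]_n -> V -> V) (q : 'I_d -> 'rV[R]_n) (B : R) (x : V) :
  sq_complete dot -> sq_closed dot C -> real_convex C ->
  (forall c, C c -> dot c c <= B) ->
  (forall a y, orthant R n a -> C y -> C (T a y)) ->
  (forall a b y, orthant R n a -> orthant R n b -> C y ->
    T (a + b) y = T a (T b y)) ->
  (forall a y z, orthant R n a -> C y -> C z ->
    dot (T a y - T a z) (T a y - T a z) <= dot (y - z) (y - z)) ->
  (forall j, orthant R n (q j)) -> C x ->
  exists z, [/\ C z, forall j, T (q j) z = z &
    forall (L : {scalar V}) M, dot_bounded dot L M ->
      box_mean k
        (fun nu : {ffun 'I_d -> nat} => L (T (\sum_j (nu j)%:R *: q j) x))
        @[k --> \oo] --> L z].
Proof.
move=> dot_complete C_closed C_convex CB T_stable TD T_ne q_orth Cx.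
pose u (nu : {ffun 'I_d -> nat}) := T (\sum_j (nu j)%:R *: q j) x.
have nu_orth (nu : {ffun 'I_d -> nat}) : orthant R n (\sum_j (nu j)%:R *: q j).
  apply: big_ind => [|a b|j _]; [exact: orthant0|exact: orthantD|].
  exact: orthantZ.
have Cu nu : C (u nu) by exact: T_stable.
have [] := @mean_ergodic _ _ dot C d (fun j => T (q j)) u B dot_complete C_closed C_convex.
- by move=> j y z; exact: T_ne.
- exact: Cu.
- move=> j nu; rewrite /u -TD //; congr (T _ x).
  rewrite (bigD1 j) //= [in RHS](bigD1 j) //= addrA; congr (_ + _).
    by rewrite !ffunE eqxx natrD scalerDl scale1r addrC.
  by apply: eq_bigr => i /negbTE ij; rewrite !ffunE ij addr0.
- by move=> nu; exact: CB.
move=> z [Cz Tz zP]; exists z; split=> // L M LM.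
have [v Lv] := riesz dot_complete LM.
have -> : L z = dot z v by rewrite Lv dot_sym.
rewrite (_ : (fun nu : {ffun _} => L _) = (fun nu => dot (u nu) v)); last first.
  by apply/funext => nu; rewrite Lv dot_sym.
exact: zP.
Qed.

(* emb embeds R in the scalars K, which are R or R[i]; re is the real part. *)
Section ScalarField.
Variables (R : realType) (K : numFieldType) (theta : K -> K).
Variables (emb : {rmorphism R -> K}) (re : K -> R).
Hypothesis emb_le : {mono emb : a b / a <= b}.
Hypothesis emb_pos : forall d : K, 0 < d -> exists r, d = emb r.
Hypothesis re_sub : zmod_morphism re.
Hypothesis re_emb : forall a k, re (emb a * k) = a * re k.
Hypothesis re_embK : cancel emb re.
Hypothesis re_theta : forall k, re (theta k) = re k.
Hypothesis re_norm : forall k, emb `|re k| <= `|k|.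
Hypothesis re_cvg : forall (g : nat -> K^o) (l : K^o),
  (forall c : K, re (c * g k) @[k --> \oo] --> re (c * l)) -> g k @[k --> \oo] --> l.

Let reD : {morph re : a b / a + b}.
Proof.
move=> a b; have re0 : re 0 = 0 by rewrite -(subrr 0) re_sub subrr.
have reN c : re (- c) = - re c by rewrite -sub0r re_sub re0 sub0r.
by rewrite -{1}[b]opprK re_sub reN opprK.
Qed.

(** * The real form of a Hilbert space over K *)

Section RealForm.
Variables (E : completeNormedModType K) (dot : {dot E for theta}).
Hypothesis E_hilbert : norm_from_dot dot.
Local Notation V := (restrict_scalars emb E).

Let rdot (u v : V) : R := re (dot u v).

Let rdot_sym u v : rdot u v = rdot v u.
Proof. by rewrite /rdot (@hermitian_subproof _ _ _ _ dot u v) expr0 mul1r re_theta. Qed.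

Let rdot_linearl v : scalar (rdot^~ v).
Proof.
move=> a u w; rewrite /rdot restrict_scaleE (linearDl dot) (linearZl_LR dot) /=.
by rewrite reD re_emb.
Qed.

Let rdot_bilinear : bilinear_for
  (GRing.Scale.Law.clone _ _ ( *%R ) _ ) (GRing.Scale.Law.clone _ _ (idfun \; *%R ) _) rdot.
Proof.
split=> [v|u]; first exact: rdot_linearl.
by move=> a v w; rewrite rdot_sym rdot_linearl !(rdot_sym _ u).
Qed.

(** A squared norm already lies in the image of [emb], so its real part loses nothing. *)
Let emb_rdot u : emb (rdot u u) = `|u : E| ^+ 2.
Proof.
have [r ur] : exists r, `|u : E| ^+ 2 = emb r.
  have [->|u0] := eqVneq (u : E) 0; first by exists 0; rewrite normr0 expr0n rmorph0.
  by apply: emb_pos; rewrite exprn_gt0 // normr_gt0.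
by rewrite /rdot -E_hilbert ur re_embK.
Qed.

Let emb_lt : {mono emb : a b / a < b}.
Proof. exact: leW_mono. Qed.

Let rdot_herm u v : rdot u v = (-1) ^+ false * idfun (rdot v u).
Proof. by rewrite expr0 mul1r rdot_sym. Qed.

Let rdot_pos (u : V) : u != 0 -> 0 < rdot u u.
Proof.
move=> u0; rewrite -emb_lt rmorph0 emb_rdot exprn_gt0 // normr_gt0.
exact: u0.
Qed.

Definition real_dot : {dot V for idfun} := HB.pack rdot
  (bilinear_isBilinear.Build R V V R _ _ rdot rdot_bilinear)
  (isHermitianSesquilinear.Build R V false idfun rdot rdot_herm)
  (isDotProduct.Build R V rdot rdot_pos).

Local Notation rd := real_dot.

Lemma emb_real_dot u : emb (rd u u) = `|u : E| ^+ 2.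
Proof. exact: emb_rdot. Qed.

Lemma real_dot_lt (u : V) r : 0 < r -> (rd u u < r ^+ 2) = (`|u : E| < emb r).
Proof.
move=> r0; rewrite -emb_lt emb_real_dot rmorphXn ltr_pXn2r // nnegrE //.
by rewrite -(rmorph0 emb) emb_le ltW.
Qed.

Lemma real_dot_cvgP (s : nat -> E) (l : E) :
  sq_cvg rd s l <-> s @ \oo --> l.
Proof.
split=> [sl|/cvgrPdist_lt sl e e0].
  apply/cvgrPdist_lt => e e0; have [r er] := emb_pos e0.
  have r0 : 0 < r by rewrite -emb_lt rmorph0 -er.
  have [N sN] := sl _ (exprn_gt0 2 r0); exists N => // k /= Nk.
  by rewrite distrC er -real_dot_lt // sN.
have r0 : 0 < Num.sqrt e by rewrite sqrtr_gt0.
have er0 : 0 < emb (Num.sqrt e) by rewrite -(rmorph0 emb) emb_lt.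
have [N _ sN] := sl _ er0; exists N => k Nk.
by rewrite -(sqr_sqrtr (ltW e0)) real_dot_lt // distrC; exact: sN.
Qed.

Lemma real_dot_complete : sq_complete rd.
Proof.
move=> s s_cauchy.
have /cvg_ex[l sl] : cvg ((s : nat -> E) @ \oo).
  apply: cauchy_cvg; apply: cauchy_exP => e e0; have [r er] := emb_pos e0.
  have r0 : 0 < r by rewrite -emb_lt rmorph0 -er.
  have [N sN] := s_cauchy _ (exprn_gt0 2 r0).
  exists (s N); exists N => // k /= Nk; rewrite -ball_normE /=.
  by rewrite er -real_dot_lt // sN.
by exists l; apply/real_dot_cvgP.
Qed.

Lemma real_dot_closed (C : set E) : closed C -> sq_closed rd C.
Proof.
move=> C_closed s l Cs /real_dot_cvgP sl.
by apply: (closed_cvg _ C_closed _ _ sl); apply: nearW.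
Qed.

Lemma real_convexP (C : set E) : convex_set C -> @real_convex R V C.
Proof.
move=> C_convex a b t Ca Cb /andP[t0 t1].
have e0 : 0 <= emb t by rewrite -(rmorph0 emb) emb_le ltW.
have e1 : emb t <= 1 by rewrite -(rmorph1 emb) emb_le ltW.
have := C_convex b a (Itv01 e0 e1) (mem_set Cb) (mem_set Ca).
move=> /set_mem.
suff -> : a + t *: (b - a) = emb t *: (b : E) + (1 - emb t) *: (a : E) by [].
rewrite restrict_scaleE scalerBl scale1r scalerBr.
by rewrite [RHS]addrC -addrA [- _ + _]addrC.
Qed.

Lemma real_dot_bounded (C : set E) : bounded_set C ->
  exists B, forall c, C c -> rd c c <= B.
Proof.
move=> /pinfty_ex_gt0[M M0 CM]; have [r Mr] := emb_pos M0.
exists (r ^+ 2) => c Cc; rewrite -emb_le emb_real_dot rmorphXn -Mr.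
by rewrite lerXn2r // ?nnegrE ?normr_ge0 ?(ltW M0) //; exact: CM.
Qed.

Lemma linear_dot_bounded (f : {linear E -> K^o}) (c : K) : continuous f ->
  exists M, dot_bounded rd (fun y => re (c * f y)) M.
Proof.
move=> f_cont.
have /linear_boundedP/pinfty_ex_gt0[M M0 fM] := continuous_linear_bounded 0 (f_cont 0).
(* The summand 1 keeps the constant positive when c = 0, as [emb_pos] requires. *)
have M0' : 0 < (`|c| + 1) * M by rewrite mulr_gt0 // ltr_wpDl.
have [r Mr] := emb_pos M0'.
exists (r ^+ 2) => y.
have h : `|re (c * f y)| ^+ 2 <= r ^+ 2 * rd y y.
  rewrite -emb_le rmorphM !rmorphXn emb_real_dot -exprMn lerXn2r //.
  - by rewrite nnegrE -(rmorph0 emb) emb_le.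
  - by rewrite nnegrE mulr_ge0 // -Mr ltW.
  apply: le_trans (re_norm _) _; rewrite normrM -Mr -mulrA.
  by apply: ler_pM => //; rewrite lerDl.
have y0 := sqdot_ge0 rd y.
rewrite real_normK ?num_real // in h.
have r20 := sqr_ge0 r.
have : (re (c * f y) *+ 2) ^+ 2 <= (r ^+ 2 + rd y y) ^+ 2.
  have := sqr_ge0 (r ^+ 2 - rd y y); rewrite mulr2n; nra.
rewrite -real_normK ?num_real // ler_pXn2r ?nnegrE ?addr_ge0 //.
exact: le_trans (ler_norm _).
Qed.

End RealForm.

Theorem weak_convergence_over (n : nat) (E : completeNormedModType K) (dot : {dot E for theta})
  (E_hilbert : norm_from_dot dot)
  (tau : topology_on E) (tau_hausdorff : hausdorff_space (with_topology tau))
  (C : set E) (C_bounded : bounded_set C) (C_closed : closed C)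
  (C_convex : convex_set C)
  (T : 'rV[R]_n -> E -> E) (T_semigroup : nonexpansive_semigroup tau C T)
  (p : n.-tuple 'rV[R]_n) (p_orthant : forall j : 'I_n, orthant R n p`_j)
  (p_free : free p)
  (alpha : n.-tuple R) (alpha_indep : rationally_independent (1 :: alpha))
  (p0 : 'rV[R]_n) (p0_def : p0 = \sum_(j < n) alpha`_j *: p`_j)
  (p0_orthant : orthant R n p0)
  (x : E) (x_in_C : C x)
  (x_ : nat -> E)
  (x_def : forall k : nat, (0 < k)%N ->
    x_ k = (k%:R ^+ n.+1)^-1 *:
      \sum_(nu : {ffun 'I_n.+1 -> 'I_k})
        T (\sum_(j < n.+1) (nu j).+1%:R *: (p0 :: p)`_j) x) :
  exists z : E, common_fixed_point C T z /\ weakly_converges x_ z.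
Proof.
have rd_complete : sq_complete (real_dot E_hilbert) by exact: real_dot_complete.
have rd_closed : sq_closed (real_dot E_hilbert) C by exact: real_dot_closed.
have rd_convex : @real_convex R (restrict_scalars emb E) C by exact: real_convexP.
have [B CB] := real_dot_bounded E_hilbert C_bounded.
have q_orth (j : 'I_n.+1) : orthant R n (p0 :: p)`_j.
  by case: j => [[|i] ij] //=; exact: (p_orthant (Ordinal (ij : (i < n)%N))).
have [] := @mean_ergodic_semigroup R (restrict_scalars emb E) (real_dot E_hilbert) C
  n n.+1 T (fun j => (p0 :: p)`_j) B x rd_complete rd_closed
  rd_convex CB (semigroup_stable T_semigroup) (semigroup_add T_semigroup)
  _ q_orth x_in_C.
  move=> a y z a0 Cy Cz; rewrite -emb_le !emb_real_dot lerXn2r ?nnegrE ?normr_ge0 //.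
  exact: (semigroup_nonexpansive T_semigroup a0 Cy Cz).
move=> z [Cz Tz zP]; exists z; split.
  apply: (common_fixed_pointP tau_hausdorff T_semigroup p_orthant p_free alpha_indep).
  - by rewrite -p0_def.
  - by [].
  - by rewrite -p0_def; exact: (Tz ord0).
  - by move=> j; have := Tz (lift ord0 j); rewrite lift0.
(* For each c the map y -> re (c f(y)) is R-linear and bounded, so the real theorem applies; varying
   c recovers f. *)
move=> f f_cont; apply: re_cvg => c.
have L_linear : GRing.linear_for *%R (fun y : restrict_scalars emb E => re (c * f y)).
  move=> a u v; rewrite restrict_scaleE (linearD f) (linearZ_LR f) /=.
  by rewrite mulrDr reD; congr (_ + _); rewrite -re_emb mulrCA.
pose L : {scalar (restrict_scalars emb E)} :=
  HB.pack (fun y : restrict_scalars emb E => re (c * f y))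
  (GRing.isLinear.Build R (restrict_scalars emb E) R *%R _ L_linear).
have [M LM] := linear_dot_bounded E_hilbert c f_cont.
have := zP L M LM; apply: cvg_trans; apply: near_eq_cvg.
near=> k.
have k0 : (0 < k)%N by near: k; exact: nbhs_infty_gt.
rewrite x_def // -[RHS]/(L _).
have -> : (k%:R ^+ n.+1)^-1 = emb (k%:R ^+ n.+1)^-1.
  by rewrite fmorphV rmorphXn rmorph_nat.
rewrite -(@restrict_scaleE _ _ emb E) (linearZ_LR L) linear_sum /box_mean; congr (_ * _).
apply: eq_bigr => nu _; congr (L (T _ x)); apply: eq_bigr => j _.
by rewrite ffunE.
Unshelve. all: by end_near. Qed.

End ScalarField.

(** * Real and imaginary parts of complex numbers *)

Lemma norm_Re_le (R : realType) (z : R[i]) : `|complex.Re z|%:C%C <= `|z|.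
Proof.
by rewrite normc_def lecR -sqrtr_sqr ler_wsqrtr // lerDl sqr_ge0.
Qed.

Lemma normc_le_Re_Im (R : realType) (z : R[i]) :
  `|z| <= (`|complex.Re z| + `|complex.Im z|)%:C%C.
Proof.
have r0 : 0 <= `|complex.Re z| + `|complex.Im z| by rewrite addr_ge0.
rewrite normc_def lecR -[leRHS]ger0_norm // -sqrtr_sqr ler_wsqrtr // sqrrD.
rewrite !real_normK ?num_real // lerD2r lerDl mulrn_wge0 // mulr_ge0 //.
Qed.

(** The multipliers 1 and -i extract the real and the imaginary part. *)
Lemma complex_cvg (R : realType) (g : nat -> R[i]^o) (l : R[i]^o) :
  (forall c : R[i], complex.Re (c * g k) @[k --> \oo] --> complex.Re (c * l)) ->
  g k @[k --> \oo] --> l.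
Proof.
move=> gl; apply/cvgrPdist_lt => e; rewrite ltcE /= => /andP[/eqP e_im e_re].
have eE : e = (complex.Re e)%:C%C by case: e e_im {e_re} => a b /= ->.
have e2 : 0 < complex.Re e / 2 by rewrite divr_gt0.
have ReB (z w : R[i]) : complex.Re z - complex.Re w = complex.Re (z - w).
  by case: z w => [a b] [c d].
have ReIm (z : R[i]) : complex.Re ((0 -i* 1)%C * z) = complex.Im z.
  by case: z => a b /=; rewrite mul0r mulN1r sub0r opprK.
have /cvgrPdist_lt/(_ _ e2) gre := gl 1.
have /cvgrPdist_lt/(_ _ e2) gim := gl (0 -i* 1)%C.
near=> k.
have h1 : `|complex.Re (1 * l) - complex.Re (1 * g k)| < complex.Re e / 2 by near: k.
have h2 : `|complex.Re ((0 -i* 1)%C * l) - complex.Re ((0 -i* 1)%C * g k)| < complex.Re e / 2.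
  by near: k.
rewrite eE; apply: le_lt_trans (normc_le_Re_Im _) _; rewrite ltcR.
by move: h1 h2; rewrite !mul1r !ReB -mulrBr ReIm; lra.
Unshelve. all: by end_near. Qed.

Theorem theorem6 (R : realType) (n : nat) (n_ge1 : (1 <= n)%N)
  (K : numFieldType) (theta : K -> K) (K_scalars : scalar_field R theta)
  (E : completeNormedModType K) (dot : {dot E for theta})
  (E_hilbert : norm_from_dot dot)
  (tau : topology_on E) (tau_hausdorff : hausdorff_space (with_topology tau))
  (C : set E) (C_bounded : bounded_set C) (C_closed : closed C)
  (C_convex : convex_set C)
  (T : 'rV[R]_n -> E -> E) (T_semigroup : nonexpansive_semigroup tau C T)
  (p : n.-tuple 'rV[R]_n) (p_orthant : forall j : 'I_n, orthant R n p`_j)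
  (p_free : free p)
  (alpha : n.-tuple R) (alpha_indep : rationally_independent (1 :: alpha))
  (p0 : 'rV[R]_n) (p0_def : p0 = \sum_(j < n) alpha`_j *: p`_j)
  (p0_orthant : orthant R n p0)
  (x : E) (x_in_C : C x)
  (x_ : nat -> E)
  (x_def : forall k : nat, (0 < k)%N ->
    x_ k = (k%:R ^+ n.+1)^-1 *:
      \sum_(nu : {ffun 'I_n.+1 -> 'I_k})
        T (\sum_(j < n.+1) (nu j).+1%:R *: (p0 :: p)`_j) x) :
  exists z : E, common_fixed_point C T z /\ weakly_converges x_ z.
Proof.
case: K_scalars E dot E_hilbert tau tau_hausdorff C C_bounded C_closed C_convex T
  T_semigroup x x_in_C x_ x_def.
- move=> E dot E_hilbert tau tau_hausdorff C C_bounded C_closed C_convex T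
    T_semigroup x x_in_C x_ x_def.
  apply: (@weak_convergence_over R R idfun idfun id _ _ _ _ _ _ _ _ n E dot E_hilbert tau
    tau_hausdorff C C_bounded C_closed C_convex T T_semigroup p p_orthant p_free
    alpha alpha_indep p0 p0_def p0_orthant x x_in_C x_ x_def) => //.
  + by move=> d _; exists d.
  + by move=> g l /(_ 1); under eq_cvg do rewrite mul1r; rewrite mul1r.
- move=> E dot E_hilbert tau tau_hausdorff C C_bounded C_closed C_convex T
    T_semigroup x x_in_C x_ x_def.
  apply: (@weak_convergence_over R R[i] (@Num.conj R[i]) (real_complex R) (@complex.Re R)
    _ _ _ _ _ _ _ _ n E dot E_hilbert tau
    tau_hausdorff C C_bounded C_closed C_convex T T_semigroup p p_orthant p_free
    alpha alpha_indep p0 p0_def p0_orthant x x_in_C x_ x_def) => //.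
  + exact: lecR.
  + move=> [a b]; rewrite ltcE /= => /andP[/eqP -> _].
    by exists a.
  + by move=> [a b] [c d].
  + by move=> a [b c] /=; rewrite mul0r subr0.
  + by case.
  + exact: norm_Re_le.
  + exact: complex_cvg.
Qed.
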